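(* Let $(\mathbb R^2/\Gamma,g)$ be a Riemannian torus, $g=e^{2\mu}(dx^2+dy^2)$ in global isothermal coordinates, with Gaussian curvature $K$ and the 1-pseudoform $\Lambda=(\Lambda_1,\Lambda_2)$ of weight 3 defined in the context. If the torus admits a rank 3 irreducible Killing tensor field, then there exists a constant real pseudovector $c=(c^1,c^2)\neq0$ of weight 3 such that the system $$(\nabla^\perp K)u=c^1\Lambda_1+c^2\Lambda_2,\qquad \tfrac12\Delta^2u+\mathrm{div}(K\nabla u)=-c^2\Lambda_1+c^1\Lambda_2$$ has a solution $u\in C^\infty(\mathbb R^2)$ whose partial derivatives $u_x,u_y$ are $\Gamma$-periodic.
   Context: Killing tensor field: symmetric tensor field $f$ with $\sigma\nabla f=0$ ($\sigma$ symmetrization, $\nabla$ Levi-Civita); irreducible (rank 3): not a finite sum of symmetric products of Killing fields of positive ranks. Global isothermal coordinates: $\Gamma\subset\mathbb R^2$ a lattice, $g=e^{2\mu}(dx^2+dy^2)$ with $\mu$ smooth $\Gamma$-periodic; unique up to $z=az'+b$ for a fixed orientation, and the coordinates are taken compatible with the orientation. $\nabla^\perp K$ is the vector field obtained from the gradient $\nabla K$ by rotation through the right angle in the positive direction, acting on $u$ as a derivation; $\Delta$ is the Laplace–Beltrami operator, $\mathrm{div}$ the Riemannian divergence. A pseudovector of weight $k$: to each such system a pair $(c^1,c^2)$ with $c^1+ic^2=a^k(c'^1+ic'^2)$, $c^1-ic^2=\bar a^k(c'^1-ic'^2)$ under $z=az'$. $\Lambda$ is given in global isothermal coordinates by $\Lambda_1=\mu_{xxx}-3\mu_{xyy}+10\mu_x\mu_{xx}-20\mu_y\mu_{xy}-10\mu_x\mu_{yy}+8\mu_x^3-24\mu_x\mu_y^2$,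 $\Lambda_2=3\mu_{xxy}-\mu_{yyy}+10\mu_y\mu_{xx}+20\mu_x\mu_{xy}-10\mu_y\mu_{yy}+24\mu_x^2\mu_y-8\mu_y^3$. *)

(* Defs.v *)
From Stdlib Require Import Reals List.
From Coquelicot Require Import Coquelicot.
Open Scope R_scope.

Definition fn2 := R -> R -> R.

Definition dx (f : fn2) : fn2 := fun x y => Derive (fun t => f t y) x.
Definition dy (f : fn2) : fn2 := fun x y => Derive (fun t => f x t) y.

Fixpoint Dlist (l : list bool) (f : fn2) : fn2 :=
  match l with
  | nil => f
  | b :: l' => if b then dx (Dlist l' f) else dy (Dlist l' f)
  end.

Definition smooth (f : fn2) : Prop :=
  forall l : list bool,
    (forall p : R * R, continuous (fun q : R * R => Dlist l f (fst q) (snd q)) p) /\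
    (forall x y, ex_derive (fun t => Dlist l f t y) x /\
                 ex_derive (fun t => Dlist l f x t) y).

Record lattice := {
  la1 : R; la2 : R; lb1 : R; lb2 : R;
  lattice_indep : la1 * lb2 - la2 * lb1 <> 0 }.

Definition periodic (G : lattice) (f : fn2) : Prop :=
  forall x y, f (x + la1 G) (y + la2 G) = f x y /\ f (x + lb1 G) (y + lb2 G) = f x y.

Definition torus_fun (G : lattice) (f : fn2) : Prop := smooth f /\ periodic G f.

Inductive idx := I1 | I2.
Definition idx_eqb (i j : idx) : bool :=
  match i, j with I1, I1 | I2, I2 => true | _, _ => false end.
Definition delta (i j : idx) : R := if idx_eqb i j then 1 else 0.
Definition sum2 (F : idx -> R) : R := F I1 + F I2.

Definition dd (i : idx) (f : fn2) : fn2 := match i with I1 => dx f | I2 => dy f end.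

(** Christoffel symbols Gamma^k_{ij} of g = e^{2 mu}(dx^2+dy^2):
    delta^k_i mu_j + delta^k_j mu_i - delta_ij mu_k. *)
Definition Chr (mu : fn2) (k i j : idx) : fn2 := fun x y =>
  delta k i * dd j mu x y + delta k j * dd i mu x y - delta i j * dd k mu x y.

(** Covariant (lower-index) symmetric tensor fields of ranks 1, 2, 3,
    given by their components in the global isothermal coordinates. *)
Definition tens1 := idx -> fn2.
Definition tens2 := idx -> idx -> fn2.
Definition tens3 := idx -> idx -> idx -> fn2.

Definition nab1 (mu : fn2) (v : tens1) (l i : idx) : fn2 := fun x y =>
  dd l (v i) x y - sum2 (fun p => Chr mu p l i x y * v p x y).
Definition nab2 (mu : fn2) (h : tens2) (l i j : idx) : fn2 := fun x y =>
  dd l (h i j) x y - sum2 (fun p => Chr mu p l i x y * h p j x y)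
                   - sum2 (fun p => Chr mu p l j x y * h i p x y).
Definition nab3 (mu : fn2) (f : tens3) (l i j k : idx) : fn2 := fun x y =>
  dd l (f i j k) x y - sum2 (fun p => Chr mu p l i x y * f p j k x y)
                     - sum2 (fun p => Chr mu p l j x y * f i p k x y)
                     - sum2 (fun p => Chr mu p l k x y * f i j p x y).

Definition tfield1 (G : lattice) (v : tens1) : Prop := forall i, torus_fun G (v i).
Definition tfield2 (G : lattice) (h : tens2) : Prop :=
  (forall i j, torus_fun G (h i j)) /\ (forall i j, h i j = h j i).
Definition tfield3 (G : lattice) (f : tens3) : Prop :=
  (forall i j k, torus_fun G (f i j k)) /\
  (forall i j k, f i j k = f j i k /\ f i j k = f i k j).

(** Killing tensor fields: sigma nabla f = 0.  For a symmetric tensor the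
    full symmetrization of nabla f is (up to a nonzero factor) the sum over
    the choice of the differentiation index. *)
Definition killing1 (G : lattice) (mu : fn2) (v : tens1) : Prop :=
  tfield1 G v /\ forall i j x y, nab1 mu v i j x y + nab1 mu v j i x y = 0.
Definition killing2 (G : lattice) (mu : fn2) (h : tens2) : Prop :=
  tfield2 G h /\ forall i j k x y,
    nab2 mu h i j k x y + nab2 mu h j k i x y + nab2 mu h k i j x y = 0.
Definition killing3 (G : lattice) (mu : fn2) (f : tens3) : Prop :=
  tfield3 G f /\ forall i j k l x y,
    nab3 mu f i j k l x y + nab3 mu f j k l i x y
    + nab3 mu f k l i j x y + nab3 mu f l i j k x y = 0.

Definition sprod12 (v : tens1) (h : tens2) : tens3 := fun i j k x y =>
  (v i x y * h j k x y + v j x y * h i k x y + v k x y * h i j x y) / 3.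
Definition sprod111 (v w z : tens1) : tens3 := fun i j k x y =>
  (v i x y * w j x y * z k x y + v i x y * w k x y * z j x y
   + v j x y * w i x y * z k x y + v j x y * w k x y * z i x y
   + v k x y * w i x y * z j x y + v k x y * w j x y * z i x y) / 6.

(** A summand of a decomposition: a symmetric product of Killing fields of
    positive ranks summing to 3 (ranks 1+2 or 1+1+1). *)
Inductive prod3 :=
  | P12 (v : tens1) (h : tens2)
  | P111 (v w z : tens1).

Definition prod3_killing (G : lattice) (mu : fn2) (t : prod3) : Prop :=
  match t with
  | P12 v h => killing1 G mu v /\ killing2 G mu h
  | P111 v w z => killing1 G mu v /\ killing1 G mu w /\ killing1 G mu z
  end.

Definition prod3_val (t : prod3) : tens3 :=
  match t with P12 v h => sprod12 v h | P111 v w z => sprod111 v w z end.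

Definition sum_prod3 (l : list prod3) : tens3 := fun i j k x y =>
  fold_right (fun t acc => prod3_val t i j k x y + acc) 0 l.

Definition reducible3 (G : lattice) (mu : fn2) (f : tens3) : Prop :=
  exists l : list prod3, List.Forall (prod3_killing G mu) l /\
    forall i j k x y, f i j k x y = sum_prod3 l i j k x y.

Definition irreducible_killing3 (G : lattice) (mu : fn2) (f : tens3) : Prop :=
  killing3 G mu f /\ ~ reducible3 G mu f.

Definition gaussK (mu : fn2) : fn2 := fun x y =>
  - exp (-2 * mu x y) * (dx (dx mu) x y + dy (dy mu) x y).

Definition Lambda1 (mu : fn2) : fn2 := fun x y =>
  dx (dx (dx mu)) x y - 3 * dx (dy (dy mu)) x y
  + 10 * dx mu x y * dx (dx mu) x y - 20 * dy mu x y * dx (dy mu) x y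
  - 10 * dx mu x y * dy (dy mu) x y + 8 * (dx mu x y) ^ 3
  - 24 * dx mu x y * (dy mu x y) ^ 2.
Definition Lambda2 (mu : fn2) : fn2 := fun x y =>
  3 * dx (dx (dy mu)) x y - dy (dy (dy mu)) x y
  + 10 * dy mu x y * dx (dx mu) x y + 20 * dx mu x y * dx (dy mu) x y
  - 10 * dy mu x y * dy (dy mu) x y + 24 * (dx mu x y) ^ 2 * dy mu x y
  - 8 * (dy mu x y) ^ 3.

Definition LB (mu : fn2) (u : fn2) : fn2 := fun x y =>
  exp (-2 * mu x y) * (dx (dx u) x y + dy (dy u) x y).

(** (nabla^perp K) u, with nabla K = e^{-2mu}(K_x,K_y) rotated by +pi/2. *)
Definition perpK_u (mu : fn2) (u : fn2) : fn2 := fun x y =>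
  exp (-2 * mu x y) * (- dy (gaussK mu) x y * dx u x y + dx (gaussK mu) x y * dy u x y).

Definition divKgrad (mu : fn2) (u : fn2) : fn2 := fun x y =>
  exp (-2 * mu x y) *
  (dx (fun a b => gaussK mu a b * dx u a b) x y
   + dy (fun a b => gaussK mu a b * dy u a b) x y).

(* Main.v *)
(** Write the cubic form of the Killing field as [A zeta^3 + B zeta^2 zeta* + conjugate].  The
    Killing equation makes [e^{-6 mu} A] antiholomorphic, hence constant by periodicity (a
    periodic solution of the Cauchy-Riemann equations attains its maximum, and the mean over
    circles spreads it to the whole plane).  If the constant is [0], the field is the product of
    the metric with a Killing vector field; so irreducibility makes it nonzero.  The trace part
    of the equation says that [e^{-2 mu} B] is divergence free, so it is [2 i u_z] up to a factor
    for a real potential [u], and the remaining part becomes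
    [u_zz - 2 mu_z u_z = const e^{4 mu} mu_{z*}].  Applying [e^{-2 mu} d_{z*} e^{-2 mu} d_{z*}]
    to it and separating real and imaginary parts gives the fourth-order system. *)

Require Import Defs.
From Stdlib Require Import Reals List Lra Classical FunctionalExtensionality.
From Coquelicot Require Import Coquelicot.
Open Scope R_scope.

(** * Continuity, partial derivatives and smoothness of functions on the plane *)

Lemma fn2_ext (f g : fn2) : (forall x y, f x y = g x y) -> f = g.
Proof.
  intros H; apply functional_extensionality; intros x.
  apply functional_extensionality; intros y; apply H.
Qed.

Definition cont2 (f : fn2) : Prop := forall x y, continuity_2d_pt f x y.

Lemma cont2_iff (f : fn2) :
  cont2 f <-> forall p : R * R, continuous (fun q : R * R => f (fst q) (snd q)) p.
Proof.
  split.
  - intros H [x y]. apply continuity_2d_pt_filterlim, H.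
  - intros H x y. apply continuity_2d_pt_filterlim, (H (x, y)).
Qed.

Definition has_partials (f fx fy : fn2) : Prop :=
  forall x y, is_derive (fun t => f t y) x (fx x y) /\ is_derive (fun t => f x t) y (fy x y).

Lemma has_partials_dx (f fx fy : fn2) : has_partials f fx fy -> dx f = fx.
Proof. intros H; apply fn2_ext; intros x y. apply is_derive_unique, H. Qed.

Lemma has_partials_dy (f fx fy : fn2) : has_partials f fx fy -> dy f = fy.
Proof. intros H; apply fn2_ext; intros x y. apply (is_derive_unique (fun t => f x t)), H. Qed.

(** An increment splits into a step in x, controlled uniformly by the continuity of [fx], and a step
    in y along a fixed vertical line. *)
Lemma C1_differentiable (f fx fy : fn2) (x y : R) :
  has_partials f fx fy -> cont2 fx -> differentiable_pt_lim f x y (fx x y) (fy x y).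
Proof.
  intros H Hc. apply filterdiff_differentiable_pt_lim.
  apply (is_derive_filterdiff f x y fx (fy x y)).
  - apply filter_forall; intros u; apply H.
  - apply H.
  - apply (proj1 (cont2_iff fx) Hc (x, y)).
Qed.

Lemma C1_cont2 (f fx fy : fn2) : has_partials f fx fy -> cont2 fx -> cont2 f.
Proof.
  intros H Hc x y. apply differentiable_continuity_pt.
  exists (fx x y), (fy x y). now apply C1_differentiable.
Qed.

Lemma Dlist_app (l m : list bool) (f : fn2) : Dlist (l ++ m) f = Dlist l (Dlist m f).
Proof. induction l as [|[] l IH]; simpl; now rewrite ?IH. Qed.

Lemma smooth_dx (f : fn2) : smooth f -> smooth (dx f).
Proof.
  intros H l. change (dx f) with (Dlist (true :: nil) f). rewrite <- Dlist_app. apply H.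
Qed.

Lemma smooth_dy (f : fn2) : smooth f -> smooth (dy f).
Proof.
  intros H l. change (dy f) with (Dlist (false :: nil) f). rewrite <- Dlist_app. apply H.
Qed.

Lemma smooth_cont2 (f : fn2) : smooth f -> cont2 f.
Proof. intros H; apply cont2_iff, (H nil). Qed.

Lemma smooth_partials (f : fn2) : smooth f -> has_partials f (dx f) (dy f).
Proof.
  intros H x y; split.
  - apply Derive_correct, (proj2 (H nil) x y).
  - apply (Derive_correct (fun t => f x t)), (proj2 (H nil) x y).
Qed.

Lemma smooth_of_partials (f fx fy : fn2) :
  has_partials f fx fy -> smooth fx -> smooth fy -> smooth f.
Proof.
  intros H Hx Hy l.
  (* The last entry of the list is the derivative taken first; it turns [f] into [fx] or [fy], whose
     smoothness covers the rest of the list. *)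
  induction l as [|b l _] using rev_ind.
  - split.
    + apply cont2_iff, (C1_cont2 f fx fy H), smooth_cont2, Hx.
    + intros x y. destruct (H x y) as [A B].
      exact (conj (ex_intro _ _ A) (ex_intro _ _ B)).
  - rewrite Dlist_app. destruct b; simpl.
    + rewrite (has_partials_dx f fx fy H). apply Hx.
    + rewrite (has_partials_dy f fx fy H). apply Hy.
Qed.

Lemma dy_dx (f : fn2) : smooth f -> dy (dx f) = dx (dy f).
Proof.
  intros H; apply fn2_ext; intros x y. symmetry. apply (Schwarz f).
  - apply locally_2d_forall; intros u v; repeat split.
    + apply (proj2 (H nil) u v).
    + apply (proj2 (H nil) u v).
    + apply (proj2 (H (false :: nil)) u v).
    + apply (proj2 (H (true :: nil)) u v).
  - apply (smooth_cont2 (dx (dy f))), smooth_dx, smooth_dy, H.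
  - apply (smooth_cont2 (dy (dx f))), smooth_dy, smooth_dx, H.
Qed.

(** * Differential expressions in smooth functions *)

(* Every [eval e] is smooth by construction, and differentiation becomes computation; mixed
   derivatives are normalized with the x-derivatives outermost. *)
Inductive expr :=
  | Cst (r : R)
  | Jet (f : fn2) (H : smooth f) (i j : nat)
  | Add (e1 e2 : expr)
  | Mul (e1 e2 : expr)
  | Exp (e : expr).

Fixpoint eval (e : expr) : fn2 :=
  match e with
  | Cst r => fun _ _ => r
  | Jet f _ i j => Nat.iter i dx (Nat.iter j dy f)
  | Add e1 e2 => fun x y => eval e1 x y + eval e2 x y
  | Mul e1 e2 => fun x y => eval e1 x y * eval e2 x y
  | Exp e => fun x y => exp (eval e x y)
  end.

(* [true] differentiates in x and [false] in y, as in [Dlist]. *)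
Fixpoint ediff (b : bool) (e : expr) : expr :=
  match e with
  | Cst _ => Cst 0
  | Jet f H i j => if b then Jet f H (S i) j else Jet f H i (S j)
  | Add e1 e2 => Add (ediff b e1) (ediff b e2)
  | Mul e1 e2 => Add (Mul (ediff b e1) e2) (Mul e1 (ediff b e2))
  | Exp e => Mul (ediff b e) (Exp e)
  end.

Lemma smooth_jet (f : fn2) (i j : nat) :
  smooth f -> smooth (Nat.iter i dx (Nat.iter j dy f)).
Proof.
  intros H. induction i as [|i IH]; simpl; [|now apply smooth_dx].
  induction j as [|j IH]; simpl; [|apply smooth_dy]; auto.
Qed.

(** Carries a new y-derivative past the x-derivatives, into the normal form that [ediff] produces on
    a [Jet]. *)
Lemma dy_jet (f : fn2) (i j : nat) :
  smooth f ->
  dy (Nat.iter i dx (Nat.iter j dy f)) = Nat.iter i dx (dy (Nat.iter j dy f)).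
Proof.
  intros H. induction i as [|i IH]; [reflexivity|].
  simpl Nat.iter at 1. rewrite dy_dx by now apply smooth_jet.
  now rewrite IH.
Qed.

Lemma cont2_eval (e : expr) : cont2 (eval e).
Proof.
  induction e as [r|f H i j|e1 IH1 e2 IH2|e1 IH1 e2 IH2|e IH]; intros x y; simpl.
  - apply continuity_2d_pt_const.
  - now apply smooth_cont2, smooth_jet.
  - now apply continuity_2d_pt_plus.
  - now apply continuity_2d_pt_mult.
  - apply continuity_1d_2d_pt_comp; [|apply IH].
    apply derivable_continuous_pt, derivable_pt_exp.
Qed.

Lemma has_partials_eval (e : expr) :
  has_partials (eval e) (eval (ediff true e)) (eval (ediff false e)).
Proof.
  induction e as [r|f H i j|e1 IH1 e2 IH2|e1 IH1 e2 IH2|e IH]; intros x y; simpl.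
  - split; apply @is_derive_const.
  - rewrite <- (dy_jet f i j H). now apply smooth_partials, smooth_jet.
  - split; apply @is_derive_plus; first [apply IH1 | apply IH2].
  - destruct (IH1 x y) as [A1 B1], (IH2 x y) as [A2 B2].
    split.
    + apply (is_derive_mult (fun t => eval e1 t y) (fun t => eval e2 t y) x _ _ A1 A2).
      exact Rmult_comm.
    + apply (is_derive_mult (fun t => eval e1 x t) (fun t => eval e2 x t) y _ _ B1 B2).
      exact Rmult_comm.
  - destruct (IH x y) as [A B].
    split.
    + apply (is_derive_comp exp (fun t => eval e t y) x _ _ (is_derive_exp _) A).
    + apply (is_derive_comp exp (fun t => eval e x t) y _ _ (is_derive_exp _) B).
Qed.

Lemma dx_eval (e : expr) : dx (eval e) = eval (ediff true e).
Proof. exact (has_partials_dx _ _ _ (has_partials_eval e)). Qed.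

Lemma dy_eval (e : expr) : dy (eval e) = eval (ediff false e).
Proof. exact (has_partials_dy _ _ _ (has_partials_eval e)). Qed.

(** Expressions are closed under [ediff], so every iterated derivative is again some [eval e'],
    which is continuous and has partial derivatives. *)
Lemma smooth_eval (e : expr) : smooth (eval e).
Proof.
  intros l.
  assert (exists e', Dlist l (eval e) = eval e') as [e' ->].
  { induction l as [|[] l [e' IH]]; simpl.
    - now exists e.
    - exists (ediff true e'). now rewrite IH, dx_eval.
    - exists (ediff false e'). now rewrite IH, dy_eval. }
  split; [apply cont2_iff, cont2_eval|].
  intros x y. destruct (has_partials_eval e' x y) as [A B].
  exact (conj (ex_intro _ _ A) (ex_intro _ _ B)).
Qed.

(** * Continuity under composition, arithmetic and restriction to lines *)

Lemma cont2_comp (f g h : fn2) :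
  cont2 f -> cont2 g -> cont2 h -> cont2 (fun s t => f (g s t) (h s t)).
Proof.
  intros Hf Hg Hh. apply cont2_iff. intros p.
  apply (continuous_comp_2 (fun q : R * R => g (fst q) (snd q))
           (fun q : R * R => h (fst q) (snd q)) f).
  - now apply cont2_iff.
  - now apply cont2_iff.
  - now apply (proj1 (cont2_iff f)).
Qed.

Lemma cont2_const (c : R) : cont2 (fun _ _ => c).
Proof. intros x y; apply continuity_2d_pt_const. Qed.

Lemma cont2_plus (f g : fn2) : cont2 f -> cont2 g -> cont2 (fun x y => f x y + g x y).
Proof. intros Hf Hg x y; now apply continuity_2d_pt_plus. Qed.

Lemma cont2_mult (f g : fn2) : cont2 f -> cont2 g -> cont2 (fun x y => f x y * g x y).
Proof. intros Hf Hg x y; now apply continuity_2d_pt_mult. Qed.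

Lemma cont2_snd (f : R -> R) : continuity f -> cont2 (fun _ y => f y).
Proof.
  intros H x y. apply continuity_1d_2d_pt_comp; [apply H | apply continuity_2d_pt_id2].
Qed.

Lemma cont2_slice_fst (f : fn2) (y x : R) : cont2 f -> continuous (fun t => f t y) x.
Proof.
  intros H. apply (continuous_comp_2 (fun t => t) (fun _ => y) f).
  - apply continuous_id.
  - apply continuous_const.
  - now apply (proj1 (cont2_iff f)).
Qed.

Lemma cont2_slice_snd (f : fn2) (x y : R) : cont2 f -> continuous (fun t => f x t) y.
Proof.
  intros H. apply (continuous_comp_2 (fun _ => x) (fun t => t) f).
  - apply continuous_const.
  - apply continuous_id.
  - now apply (proj1 (cont2_iff f)).
Qed.

(** * Liouville's theorem for periodic functions *)

(** Uniform continuity gives a [d] within which [g] varies by less than 1. Walking from the origin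
    to [(s, t)] in [N > 1 / d] equal steps changes [g] by at most [N]. *)
Lemma bounded_on_square (g : fn2) :
  cont2 g ->
  exists B, forall s t, 0 <= s <= 1 -> 0 <= t <= 1 -> Rabs (g s t) <= B.
Proof.
  intros Hg.
  destruct (uniform_continuity_2d g 0 1 0 1 (fun x y _ _ => Hg x y) (mkposreal 1 Rlt_0_1))
    as [d Hd]; simpl in Hd.
  destruct (INR_unbounded (/ d)) as [N HN].
  assert (Hd0 := cond_pos d).
  assert (HN0 : 0 < INR N).
  { apply Rlt_trans with (/ d); [now apply Rinv_0_lt_compat | exact HN]. }
  assert (HNd : / INR N < d).
  { rewrite <- (Rinv_inv d). apply Rinv_lt_contravar; [|exact HN].
    apply Rmult_lt_0_compat; [now apply Rinv_0_lt_compat | exact HN0]. }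
  exists (Rabs (g 0 0) + INR N). intros s t Hs Ht.
  assert (step : forall k, (k <= N)%nat ->
    Rabs (g (s * (INR k / INR N)) (t * (INR k / INR N)) - g 0 0) <= INR k).
  { induction k as [|k IH]; intros Hk.
    - simpl. unfold Rdiv. rewrite !Rmult_0_l, !Rmult_0_r, Rminus_diag, Rabs_R0. lra.
    - specialize (IH (Nat.lt_le_incl _ _ Hk)).
      assert (Hr : forall j, (j <= N)%nat -> 0 <= INR j / INR N <= 1).
      { intros j Hj. apply le_INR in Hj. assert (H0 := pos_INR j). split.
        - apply Rmult_le_pos; [exact H0 | left; now apply Rinv_0_lt_compat].
        - apply Rmult_le_reg_r with (INR N); [exact HN0|]. field_simplify; lra. }
      assert (Hk0 := Hr k (Nat.lt_le_incl _ _ Hk)). assert (Hk1 := Hr (S k) Hk).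
      assert (Hdiff : INR (S k) / INR N = INR k / INR N + / INR N)
        by (rewrite S_INR; field; lra).
      set (a := INR k / INR N) in *. set (b := INR (S k) / INR N) in *.
      assert (Hi : 0 < / INR N) by now apply Rinv_0_lt_compat.
      assert (H1 : Rabs (g (s * b) (t * b) - g (s * a) (t * a)) < 1).
      { apply Hd; try nra; apply Rabs_def1; nra. }
      rewrite S_INR.
      replace (g (s * b) (t * b) - g 0 0)
        with ((g (s * b) (t * b) - g (s * a) (t * a)) + (g (s * a) (t * a) - g 0 0)) by ring.
      eapply Rle_trans; [apply Rabs_triang|]. lra. }
  specialize (step N (Nat.le_refl N)).
  replace (INR N / INR N) with 1 in step by (field; lra).
  rewrite !Rmult_1_r in step.
  replace (g s t) with ((g s t - g 0 0) + g 0 0) by ring.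
  eapply Rle_trans; [apply Rabs_triang|]. lra.
Qed.

Lemma periodic_Z (f : fn2) (a b : R) :
  (forall x y, f (x + a) (y + b) = f x y) ->
  forall (n : Z) x y, f (x + IZR n * a) (y + IZR n * b) = f x y.
Proof.
  intros H n. induction n as [|n IH|n IH] using Z.peano_ind; intros x y.
  - f_equal; ring.
  - rewrite succ_IZR, <- (IH x y), <- (H (x + IZR n * a)). f_equal; ring.
  - unfold Z.pred. rewrite plus_IZR, <- (IH x y), <- (H (x + (IZR n + -1) * a)).
    f_equal; ring.
Qed.

(** In the lattice basis the unit square is a fundamental domain: Cramer's rule gives the
    coordinates [s], [t] of a point, and dropping their integer parts moves it into the square
    without changing [f]. *)
Lemma periodic_bounded (G : lattice) (f : fn2) :
  cont2 f -> periodic G f -> exists B, forall x y, Rabs (f x y) <= B.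
Proof.
  intros Hc Hp.
  set (g := fun s t => f (s * la1 G + t * lb1 G) (s * la2 G + t * lb2 G)).
  assert (Hlin : forall a b, cont2 (fun s t => s * a + t * b)).
  { intros a b x y.
    apply continuity_2d_pt_plus; apply continuity_2d_pt_mult;
      auto using continuity_2d_pt_id1, continuity_2d_pt_id2, continuity_2d_pt_const. }
  destruct (bounded_on_square g) as [B HB]; [exact (cont2_comp f _ _ Hc (Hlin _ _) (Hlin _ _))|].
  exists B. intros x y.
  assert (HD := lattice_indep G).
  set (D := la1 G * lb2 G - la2 G * lb1 G) in HD.
  set (s := (x * lb2 G - y * lb1 G) / D).
  set (t := (la1 G * y - la2 G * x) / D).
  destruct (base_Int_part s) as [Hs1 Hs2], (base_Int_part t) as [Ht1 Ht2].
  specialize (HB (s - IZR (Int_part s)) (t - IZR (Int_part t))).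
  replace (f x y) with (g (s - IZR (Int_part s)) (t - IZR (Int_part t))).
  { apply HB; lra. }
  unfold g.
  rewrite <- (periodic_Z f (la1 G) (la2 G) (fun x y => proj1 (Hp x y)) (Int_part s)).
  rewrite <- (periodic_Z f (lb1 G) (lb2 G) (fun x y => proj2 (Hp x y)) (Int_part t)).
  f_equal; unfold s, t, D; field; exact HD.
Qed.

Lemma periodic_max (G : lattice) (f : fn2) :
  cont2 f -> periodic G f -> exists x0 y0, forall x y, f x y <= f x0 y0.
Proof.
  intros Hc Hp.
  destruct (periodic_bounded G f Hc Hp) as [B HB].
  destruct (completeness (fun r => exists x y, r = f x y)) as [M [HM1 HM2]].
  - exists B. intros r (x & y & ->). specialize (HB x y). apply Rabs_le_between in HB. lra.
  - exists (f 0 0), 0, 0. reflexivity.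
  - destruct (classic (exists x0 y0, f x0 y0 = M)) as [(x0 & y0 & E)|N].
    + exists x0, y0. intros x y. rewrite E. apply HM1. now exists x, y.
    + exfalso.
      assert (Hlt : forall x y, 0 < M - f x y).
      { intros x y. assert (f x y <= M) by (apply HM1; now exists x, y).
        destruct (Req_dec (f x y) M) as [E|E]; [|lra]. elim N. now exists x, y. }
      (* [1 / (M - f)] is again continuous and periodic, hence bounded. *)
      destruct (periodic_bounded G (fun x y => / (M - f x y))) as [C HC].
      * intros x y. apply (continuity_2d_pt_inv (fun x y => M - f x y)).
        -- apply continuity_2d_pt_minus; [apply continuity_2d_pt_const | apply Hc].
        -- specialize (Hlt x y). lra.
      * intros x y. destruct (Hp x y) as [E1 E2]. now rewrite E1, E2.
      * assert (HC0 : 0 < C).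
        { specialize (HC 0 0). specialize (Hlt 0 0).
          assert (0 < / (M - f 0 0)) by now apply Rinv_0_lt_compat.
          apply Rabs_le_between in HC. lra. }
        (* A bound [C] on [1 / (M - f)] makes [M - 1 / C] an upper bound of [f], against the
           minimality of [M]. *)
        assert (M <= M - / C).
        { apply HM2. intros r (x & y & ->).
          specialize (HC x y). specialize (Hlt x y).
          apply Rabs_le_between in HC. destruct HC as [_ HC].
          apply Rinv_le_contravar in HC; [|now apply Rinv_0_lt_compat].
          rewrite Rinv_inv in HC. lra. }
        assert (0 < / C) by now apply Rinv_0_lt_compat. lra.
Qed.

Lemma ex_RInt_cont (h : R -> R) (a b : R) : (forall s, continuous h s) -> ex_RInt h a b.
Proof. intros H. apply (@ex_RInt_continuous R_CompleteNormedModule). auto. Qed.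

(** The integrals over [[a, s]] and [[s, b]] are nonnegative with sum 0, so the first vanishes for
    every [s] inside. Its derivative at [t] is therefore both [h t] and 0. *)
Lemma RInt_nonneg_eq_0 (h : R -> R) (a b t : R) :
  (forall s, continuous h s) -> (forall s, 0 <= h s) -> RInt h a b = 0 ->
  a < t < b -> h t = 0.
Proof.
  intros Hc Hp H0 Ht.
  assert (Hex : forall c d, ex_RInt h c d) by (intros; now apply ex_RInt_cont).
  assert (Hz : forall s, a < s < b -> RInt h a s = 0).
  { intros s Hs.
    assert (0 <= RInt h a s) by (apply RInt_ge_0; auto; lra).
    assert (0 <= RInt h s b) by (apply RInt_ge_0; auto; lra).
    assert (E := RInt_Chasles h a s b (Hex _ _) (Hex _ _)).
    change plus with Rplus in E. lra. }
  assert (D1 : is_derive (fun s => RInt h a s) t (h t)).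
  { apply is_derive_RInt with a; [|apply Hc].
    apply filter_forall; intros s. apply (RInt_correct h a s), Hex. }
  assert (D2 : is_derive (fun s => RInt h a s) t 0).
  { apply is_derive_ext_loc with (fun _ => 0); [|apply @is_derive_const].
    assert (Hr : 0 < Rmin (t - a) (b - t)) by (apply Rmin_pos; lra).
    exists (mkposreal _ Hr). intros s Hs.
    change (Rabs (s - t) < Rmin (t - a) (b - t)) in Hs.
    assert (A1 := Rmin_l (t - a) (b - t)). assert (A2 := Rmin_r (t - a) (b - t)).
    apply Rabs_def2 in Hs. symmetry; apply Hz. lra. }
  apply is_derive_unique in D1, D2. congruence.
Qed.

(** * The mean value property over circles for solutions of the Cauchy-Riemann equations *)

Section CircleMean.

Variables (P Q : fn2).
Hypotheses (HP : smooth P) (HQ : smooth Q).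
Hypothesis CR1 : forall x y, dx P x y = dy Q x y.
Hypothesis CR2 : forall x y, dy P x y = - dx Q x y.
Variables (x y u v : R).

(* At [t = PI] the offset is [(u, v)]. *)
Let C t := - (u * cos t - v * sin t).
Let S t := - (u * sin t + v * cos t).
Let circ (f : fn2) : fn2 := fun r t => f (x + r * C t) (y + r * S t).

Lemma deriv_C t : is_derive C t (- S t).
Proof. unfold C, S. auto_derive; [trivial | ring]. Qed.

Lemma deriv_S t : is_derive S t (C t).
Proof. unfold C, S. auto_derive; [trivial | ring]. Qed.

Lemma cont_C : continuity C.
Proof.
  intros t. apply continuity_pt_filterlim.
  apply (ex_derive_continuous C t). eexists; apply deriv_C.
Qed.

Lemma cont_S : continuity S.
Proof.
  intros t. apply continuity_pt_filterlim.
  apply (ex_derive_continuous S t). eexists; apply deriv_S.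
Qed.

Lemma cont_circ f : cont2 f -> cont2 (circ f).
Proof.
  intros Hf. unfold circ.
  assert (Hi : cont2 (fun r _ => r)) by (intros r t; apply continuity_2d_pt_id1).
  apply (cont2_comp f (fun r t => x + r * C t) (fun r t => y + r * S t) Hf).
  - apply (cont2_plus (fun _ _ => x)); [apply cont2_const|].
    apply (cont2_mult (fun r _ => r)); [exact Hi | apply cont2_snd, cont_C].
  - apply (cont2_plus (fun _ _ => y)); [apply cont2_const|].
    apply (cont2_mult (fun r _ => r)); [exact Hi | apply cont2_snd, cont_S].
Qed.

Lemma circ_partials f :
  smooth f ->
  has_partials (circ f)
    (fun r t => circ (dx f) r t * C t + circ (dy f) r t * S t)
    (fun r t => r * (- circ (dx f) r t * S t + circ (dy f) r t * C t)).
Proof.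
  intros Hf r t.
  assert (D := C1_differentiable f (dx f) (dy f) (x + r * C t) (y + r * S t)
                 (smooth_partials f Hf) (smooth_cont2 _ (smooth_dx f Hf))).
  split; apply is_derive_Reals.
  - apply (derivable_pt_lim_comp_2d f (fun s => x + s * C t) (fun s => y + s * S t) r
             _ _ (C t) (S t) D); apply is_derive_Reals; auto_derive; trivial; ring.
  - replace (r * (- circ (dx f) r t * S t + circ (dy f) r t * C t))
      with (dx f (x + r * C t) (y + r * S t) * (r * - S t)
            + dy f (x + r * C t) (y + r * S t) * (r * C t)) by (unfold circ; ring).
    apply (derivable_pt_lim_comp_2d f (fun s => x + r * C s) (fun s => y + r * S s) t
             _ _ _ _ D); apply is_derive_Reals.
    + rewrite <- (Rplus_0_l (r * _)).
      apply (is_derive_plus (fun _ => x)); [apply @is_derive_const|].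
      apply (is_derive_scal C), deriv_C.
    + rewrite <- (Rplus_0_l (r * _)).
      apply (is_derive_plus (fun _ => y)); [apply @is_derive_const|].
      apply (is_derive_scal S), deriv_S.
Qed.

(** The radial derivative of [circ P]. *)
Let dcirc : fn2 := fun r t => circ (dx P) r t * C t + circ (dy P) r t * S t.

Lemma cont_dcirc : cont2 dcirc.
Proof.
  apply cont2_plus; apply cont2_mult.
  - apply cont_circ, smooth_cont2, smooth_dx, HP.
  - apply cont2_snd, cont_C.
  - apply cont_circ, smooth_cont2, smooth_dy, HP.
  - apply cont2_snd, cont_S.
Qed.

(* By the Cauchy-Riemann equations [r * dcirc r] is the angular derivative of [Q]. *)
Lemma RInt_dcirc r : r <> 0 -> RInt (fun t => dcirc r t) 0 (2 * PI) = 0.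
Proof.
  intros Hr.
  assert (H : is_RInt (fun t => r * dcirc r t) 0 (2 * PI)
                (minus (circ Q r (2 * PI)) (circ Q r 0))).
  { apply (is_RInt_derive (fun t => circ Q r t)).
    - intros t _. generalize (proj2 (circ_partials Q HQ r t)).
      replace (r * dcirc r t)
        with (r * (- circ (dx Q) r t * S t + circ (dy Q) r t * C t)); [trivial|].
      unfold dcirc, circ. rewrite CR1, CR2. ring.
    - intros t _. apply (cont2_slice_snd (fun r t => r * dcirc r t)).
      apply (cont2_mult (fun r _ => r)); [|apply cont_dcirc].
      intros r' t'; apply continuity_2d_pt_id1. }
  apply (@is_RInt_unique R_CompleteNormedModule) in H.
  rewrite (RInt_scal (fun t => dcirc r t)) in H.
  - change scal with Rmult in H.
    replace (minus (circ Q r (2 * PI)) (circ Q r 0)) with 0 in H.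
    + destruct (Rmult_integral _ _ H) as [E|E]; [contradiction | exact E].
    + unfold circ, C, S. rewrite cos_2PI, sin_2PI, cos_0, sin_0.
      unfold minus, plus, opp; simpl. ring.
  - apply ex_RInt_cont. intros t. apply (cont2_slice_snd dcirc), cont_dcirc.
Qed.

(** Differentiation under the integral sign shows that the integral over the circle does not depend
    on the scale [r]; at [r = 0] the circle shrinks to its centre. *)
Lemma circle_mean : RInt (fun t => circ P 1 t) 0 (2 * PI) = 2 * PI * P x y.
Proof.
  assert (HcP := cont_circ P (smooth_cont2 P HP)).
  assert (HD : forall r, is_derive (fun r => RInt (fun t => circ P r t) 0 (2 * PI)) r
                 (RInt (fun t => dcirc r t) 0 (2 * PI))).
  { intros r.
    assert (E : dcirc = fun r t => Derive (fun r => circ P r t) r).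
    { symmetry. exact (has_partials_dx _ _ _ (circ_partials P HP)). }
    rewrite E.
    apply (is_derive_RInt_param (circ P)).
    - apply filter_forall. intros r' t _. eexists. apply (circ_partials P HP r' t).
    - intros t _. rewrite <- E. apply cont_dcirc.
    - apply filter_forall. intros r'. apply ex_RInt_cont.
      intros t. now apply (cont2_slice_snd (circ P)). }
  (* The mean value theorem asks for the derivative only on the open interval, so the case [r = 0],
     excluded in [RInt_dcirc], does not arise. *)
  destruct (MVT_gen (fun r => RInt (fun t => circ P r t) 0 (2 * PI)) 0 1 (fun _ => 0))
    as (c & _ & E).
  - intros r Hr. rewrite Rmin_left in Hr by lra.
    generalize (HD r). rewrite RInt_dcirc by lra. trivial.
  - intros r _. apply continuity_pt_filterlim.
    apply (ex_derive_continuous (fun r => RInt (fun t => circ P r t) 0 (2 * PI)) r).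
    eexists; apply HD.
  - rewrite Rmult_0_l in E. apply Rminus_diag_uniq in E. rewrite E.
    rewrite (RInt_ext _ (fun _ => P x y)).
    + rewrite RInt_const. change ((2 * PI - 0) * P x y = 2 * PI * P x y). ring.
    + intros t _. unfold circ. now rewrite !Rmult_0_l, !Rplus_0_r.
Qed.

(** On the circle about the maximum through the target point, [P x y - P] is nonnegative and has
    integral 0, hence vanishes. *)
Lemma max_attained_everywhere :
  (forall a b, P a b <= P x y) -> P (x + u) (y + v) = P x y.
Proof.
  intros Hm.
  assert (HcP := cont_circ P (smooth_cont2 P HP)).
  assert (Hex : ex_RInt (fun t => circ P 1 t) 0 (2 * PI)).
  { apply ex_RInt_cont. intros t. now apply (cont2_slice_snd (circ P)). }
  assert (E : minus (P x y) (circ P 1 PI) = 0).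
  { apply (RInt_nonneg_eq_0 (fun t => minus (P x y) (circ P 1 t)) 0 (2 * PI)).
    - intros t. apply (continuous_minus (fun _ => P x y)); [apply continuous_const|].
      now apply (cont2_slice_snd (circ P)).
    - intros t. change (0 <= P x y - circ P 1 t). assert (H := Hm (x + 1 * C t) (y + 1 * S t)).
      unfold circ. lra.
    - rewrite (RInt_minus (fun _ => P x y)); [|apply ex_RInt_const|exact Hex].
      change (RInt (fun _ => P x y) 0 (2 * PI) - RInt (fun t => circ P 1 t) 0 (2 * PI) = 0).
      rewrite circle_mean, RInt_const.
      change ((2 * PI - 0) * P x y - 2 * PI * P x y = 0). ring.
    (* The parametrization puts the target at [PI] because [RInt_nonneg_eq_0] reaches only interior
       points of the interval. *)
    - assert (H := PI_RGT_0). lra. }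
  change (P x y - circ P 1 PI = 0) in E. unfold circ, C, S in E.
  rewrite cos_PI, sin_PI in E.
  replace (x + 1 * - (u * -1 - v * 0)) with (x + u) in E by ring.
  replace (y + 1 * - (u * 0 + v * -1)) with (y + v) in E by ring.
  lra.
Qed.

End CircleMean.

Lemma periodic_CR_constant (G : lattice) (P Q : fn2) :
  smooth P -> smooth Q -> periodic G P ->
  (forall x y, dx P x y = dy Q x y) -> (forall x y, dy P x y = - dx Q x y) ->
  exists c, forall x y, P x y = c.
Proof.
  intros HP HQ Hper CR1 CR2.
  destruct (periodic_max G P (smooth_cont2 P HP) Hper) as (x0 & y0 & Hm).
  exists (P x0 y0). intros x y.
  rewrite <- (max_attained_everywhere P Q HP HQ CR1 CR2 x0 y0 (x - x0) (y - y0) Hm).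
  f_equal; ring.
Qed.

(** * Potentials *)

(** Integrate the form along the x-axis and then vertically. For the x-derivative, closedness
    replaces [dx w2] by [dy w1] under the vertical integral, which then telescopes to
    [w1 x y - w1 x 0]. *)
Lemma potential (w1 w2 : fn2) :
  smooth w1 -> smooth w2 -> (forall x y, dy w1 x y = dx w2 x y) ->
  exists u, smooth u /\ dx u = w1 /\ dy u = w2.
Proof.
  intros H1 H2 Hcl.
  assert (C1 := smooth_cont2 w1 H1). assert (C2 := smooth_cont2 w2 H2).
  assert (X1 : forall y a b, ex_RInt (fun s => w1 s y) a b).
  { intros. apply ex_RInt_cont. intros z. now apply (cont2_slice_fst w1). }
  assert (X2 : forall x a b, ex_RInt (fun s => w2 x s) a b).
  { intros. apply ex_RInt_cont. intros z. now apply (cont2_slice_snd w2). }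
  set (u := fun x y => RInt (fun s => w1 s 0) 0 x + RInt (fun s => w2 x s) 0 y).
  assert (Hu : has_partials u w1 w2).
  { intros x y. split.
    - replace (w1 x y) with (w1 x 0 + RInt (fun s => dx w2 x s) 0 y).
      + apply @is_derive_plus.
        * apply (is_derive_RInt (fun s => w1 s 0) (fun x => RInt (fun s => w1 s 0) 0 x) 0 x);
            [|now apply (cont2_slice_fst w1)].
          apply filter_forall. intros s. apply (RInt_correct (fun s => w1 s 0)), X1.
        * apply (is_derive_RInt_param w2).
          -- apply filter_forall. intros s t _. apply (proj2 (H2 nil) s t).
          -- intros t _. apply (smooth_cont2 (dx w2)), smooth_dx, H2.
          -- apply filter_forall. intros s. apply X2.
      + rewrite (RInt_ext _ (Derive (fun t => w1 x t))).
        * rewrite RInt_Derive; [ring| |].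
          -- intros t _. apply (proj2 (H1 nil) x t).
          -- intros t _. apply (cont2_slice_snd (dy w1)), smooth_cont2, smooth_dy, H1.
        * intros t _. symmetry. apply Hcl.
    - replace (w2 x y) with (0 + w2 x y) by ring.
      apply (is_derive_plus (fun _ => RInt (fun s => w1 s 0) 0 x)).
      + apply @is_derive_const.
      + apply (is_derive_RInt (fun s => w2 x s) (fun y => RInt (fun s => w2 x s) 0 y) 0 y);
          [|now apply (cont2_slice_snd w2)].
        apply filter_forall. intros s. apply (RInt_correct (fun s => w2 x s)), X2. }
  exists u. split; [|split].
  - exact (smooth_of_partials u w1 w2 Hu H1 H2).
  - exact (has_partials_dx u w1 w2 Hu).
  - exact (has_partials_dy u w1 w2 Hu).
Qed.

Definition Sub (e1 e2 : expr) : expr := Add e1 (Mul (Cst (-1)) e2).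
Definition Lap (e : expr) : expr :=
  Add (ediff true (ediff true e)) (ediff false (ediff false e)).

(** Supplies the differential consequences of an identity known at every point; applied twice, it
    gives the second-order ones. *)
Lemma ediff_const (e : expr) (k : R) (b : bool) :
  (forall x y, eval e x y = k) -> forall x y, eval (ediff b e) x y = 0.
Proof.
  intros H x y. apply fn2_ext with (g := fun _ _ => k) in H.
  destruct b; [rewrite <- dx_eval | rewrite <- dy_eval]; rewrite H; unfold dx, dy;
    apply Derive_const.
Qed.

(** * From the second-order to the fourth-order system *)

Section FourthOrder.

Variables (mu u : fn2) (Hmu : smooth mu) (Hu : smooth u) (A B : R).

Let M := Jet mu Hmu.
Let U := Jet u Hu.
Let Em2 := Exp (Mul (Cst (-2)) (M 0 0)).
Let E4 := Exp (Mul (Cst 4) (M 0 0)).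
Let Kx := Mul (Mul (Cst (-1)) Em2) (Lap (M 0 0)).

Lemma gaussK_eval : gaussK mu = eval Kx.
Proof. apply fn2_ext; intros x y. unfold gaussK; simpl. ring. Qed.

Lemma LB_eval (e : expr) : LB mu (eval e) = eval (Mul Em2 (Lap e)).
Proof. apply fn2_ext; intros x y. unfold LB. now rewrite !dx_eval, !dy_eval. Qed.

(** [F1 + i F2] is four times the difference of the two sides of [u_zz - 2 mu_z u_z = (A + i B) e^{4
    mu} mu_{z*}]. *)
Let F1 := Sub (Sub (Sub (U 2 0) (U 0 2))
                   (Mul (Cst 2) (Sub (Mul (M 1 0) (U 1 0)) (Mul (M 0 1) (U 0 1)))))
              (Mul (Mul (Cst 2) E4) (Sub (Mul (Cst A) (M 1 0)) (Mul (Cst B) (M 0 1)))).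
Let F2 := Sub (Add (Mul (Cst (-2)) (U 1 1))
                   (Mul (Cst 2) (Add (Mul (M 1 0) (U 0 1)) (Mul (M 0 1) (U 1 0)))))
              (Mul (Mul (Cst 2) E4) (Add (Mul (Cst A) (M 0 1)) (Mul (Cst B) (M 1 0)))).

Hypothesis HF1 : forall x y,
  dx (dx u) x y - dy (dy u) x y - 2 * (dx mu x y * dx u x y - dy mu x y * dy u x y)
  = 2 * exp (4 * mu x y) * (A * dx mu x y - B * dy mu x y).
Hypothesis HF2 : forall x y,
  - 2 * dx (dy u) x y + 2 * (dx mu x y * dy u x y + dy mu x y * dx u x y)
  = 2 * exp (4 * mu x y) * (A * dy mu x y + B * dx mu x y).

Lemma fourth_order x y :
  perpK_u mu u x y = - B * Lambda1 mu x y - A * Lambda2 mu x y /\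
  / 2 * LB mu (LB mu u) x y + divKgrad mu u x y = A * Lambda1 mu x y - B * Lambda2 mu x y.
Proof.
  assert (Z1 : forall x y, eval F1 x y = 0).
  { intros a b. specialize (HF1 a b). simpl. lra. }
  assert (Z2 : forall x y, eval F2 x y = 0).
  { intros a b. specialize (HF2 a b). simpl. lra. }
  assert (HLB : LB mu (LB mu u) = eval (Mul Em2 (Lap (Mul Em2 (Lap (U 0 0)))))).
  { rewrite <- !LB_eval. reflexivity. }
  assert (Hdx : dx (fun a b => gaussK mu a b * dx u a b)
                = eval (ediff true (Mul Kx (U 1 0)))).
  { rewrite gaussK_eval. exact (dx_eval (Mul Kx (U 1 0))). }
  assert (Hdy : dy (fun a b => gaussK mu a b * dy u a b)
                = eval (ediff false (Mul Kx (U 0 1)))).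
  { rewrite gaussK_eval. exact (dy_eval (Mul Kx (U 0 1))). }
  unfold perpK_u, divKgrad. rewrite HLB, Hdx, Hdy, gaussK_eval, dx_eval, dy_eval.
  clear HLB Hdx Hdy HF1 HF2.
  (* With a single exponential left, the identities below are rational in [m] and the jets of [mu]
     and [u], within reach of [field]. *)
  assert (H4 : exp (4 * mu x y) = / (exp (-2 * mu x y) * exp (-2 * mu x y))).
  { rewrite <- exp_plus, <- exp_Ropp. f_equal; ring. }
  assert (Hm := exp_pos (-2 * mu x y)).
  set (d := fun b F => eval (ediff b F) x y).
  set (m := exp (-2 * mu x y)) in *.
  (* With [F = F1 + i F2] and [w] the complex conjugate of [z], the two differences are minus the
     imaginary part and the real part of [2 m^2 (F_ww - 2 mu_w F_w)]. *)
  split; apply Rminus_diag_uniq.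
  - transitivity (- / 2 * (m * m) *
      (d true (ediff true F2) - d false (ediff false F2) + 2 * d true (ediff false F1)
       - 2 * (dx mu x y * (d false F1 + d true F2) + dy mu x y * (d true F1 - d false F2)))).
    + unfold d, Lambda1, Lambda2; simpl. rewrite H4. fold m. field; lra.
    + unfold d. rewrite !(ediff_const _ 0) by (auto using (fun e => ediff_const e 0)). ring.
  - transitivity (/ 2 * (m * m) *
      (d true (ediff true F1) - d false (ediff false F1) - 2 * d true (ediff false F2)
       - 2 * (dx mu x y * (d true F1 - d false F2) - dy mu x y * (d false F1 + d true F2)))).
    + unfold d, Lambda1, Lambda2; simpl. rewrite H4. fold m. field; lra.
    + unfold d. rewrite !(ediff_const _ 0) by (auto using (fun e => ediff_const e 0)). ring.
Qed.

End FourthOrder.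

(** * Rank 3 Killing fields in components *)

(** Here [a], [b], [c], [d] stand for the components 111, 112, 122, 222 of the tensor. Each field
    is, up to a numerical factor, the component of the symmetrized covariant derivative with the
    indices in its name. *)
Record killing3_system (mu a b c d : fn2) : Prop := {
  k1111 : forall x y, dx a x y = 3 * (dx mu x y * a x y - dy mu x y * b x y);
  k1112 : forall x y, dy a x y + 3 * dx b x y
    = 6 * dy mu x y * a x y + 12 * dx mu x y * b x y - 6 * dy mu x y * c x y;
  k1122 : forall x y, dx c x y + dy b x y
    = 5 * dx mu x y * c x y + 5 * dy mu x y * b x y
      - dy mu x y * d x y - dx mu x y * a x y;
  k1222 : forall x y, dx d x y + 3 * dy c x y
    = 6 * dx mu x y * d x y + 12 * dy mu x y * c x y - 6 * dx mu x y * b x y;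
  k2222 : forall x y, dy d x y = 3 * (dy mu x y * d x y - dx mu x y * c x y) }.

Lemma tens3_normal (f : tens3) :
  (forall i j k, f i j k = f j i k /\ f i j k = f i k j) ->
  f I1 I2 I1 = f I1 I1 I2 /\ f I2 I1 I1 = f I1 I1 I2 /\
  f I2 I1 I2 = f I1 I2 I2 /\ f I2 I2 I1 = f I1 I2 I2.
Proof.
  intros H.
  assert (E1 : f I1 I2 I1 = f I1 I1 I2) by apply H.
  assert (E2 : f I2 I1 I2 = f I1 I2 I2) by apply H.
  repeat split; trivial.
  - rewrite <- E1. apply H.
  - rewrite <- E2. apply H.
Qed.

Lemma killing3_components (G : lattice) (mu : fn2) (f : tens3) :
  killing3 G mu f ->
  killing3_system mu (f I1 I1 I1) (f I1 I1 I2) (f I1 I2 I2) (f I2 I2 I2).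
Proof.
  intros [[_ Hs] Hk]. apply tens3_normal in Hs. destruct Hs as (E1 & E2 & E3 & E4).
  assert (H1 := Hk I1 I1 I1 I1). assert (H2 := Hk I1 I1 I1 I2).
  assert (H3 := Hk I1 I1 I2 I2). assert (H4 := Hk I1 I2 I2 I2).
  assert (H5 := Hk I2 I2 I2 I2).
  unfold nab3, Chr, sum2, delta in *; simpl in *; rewrite ?E1, ?E2, ?E3, ?E4 in *.
  split; intros x y;
    [specialize (H1 x y) | specialize (H2 x y) | specialize (H3 x y)
    | specialize (H4 x y) | specialize (H5 x y)]; lra.
Qed.

Lemma torus_fun_eval (G : lattice) (e : expr) : periodic G (eval e) -> torus_fun G (eval e).
Proof. intros H; split; [apply smooth_eval | exact H]. Qed.

(** * The trace-free part and the trace of a Killing field on the torus *)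

Section KillingSystem.

Variables (G : lattice) (mu a b c d : fn2).
Hypotheses (Tmu : torus_fun G mu) (Ta : torus_fun G a) (Tb : torus_fun G b)
  (Tc : torus_fun G c) (Td : torus_fun G d).
Hypothesis HK : killing3_system mu a b c d.

Let M := Jet mu (proj1 Tmu) 0 0.
Let Ja := Jet a (proj1 Ta) 0 0.
Let Jb := Jet b (proj1 Tb) 0 0.
Let Jc := Jet c (proj1 Tc) 0 0.
Let Jd := Jet d (proj1 Td) 0 0.

(** The premise says that [F] depends on the point only through the values of [mu], [a], [b], [c],
    [d] there, which a lattice translation preserves; this makes periodicity a matter of
    rewriting. *)
Lemma periodic_eval (F : fn2) :
  (forall x y x' y', mu x' y' = mu x y -> a x' y' = a x y -> b x' y' = b x y ->
     c x' y' = c x y -> d x' y' = d x y -> F x' y' = F x y) -> periodic G F.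
Proof.
  intros H x y.
  destruct (proj2 Tmu x y), (proj2 Ta x y), (proj2 Tb x y), (proj2 Tc x y), (proj2 Td x y).
  now split; apply H.
Qed.

(** [P + i Q] is [8 e^{-6 mu} A], where [A] is the coefficient of [zeta^3] in the cubic form. *)
Let P := Mul (Sub Ja (Mul (Cst 3) Jc)) (Exp (Mul (Cst (-6)) M)).
Let Q := Mul (Sub Jd (Mul (Cst 3) Jb)) (Exp (Mul (Cst (-6)) M)).

(** The goals are linear combinations of the Killing equations once products such as
    [dx mu x y * a x y] are taken as atoms. *)
Ltac by_killing x y :=
  pose proof (k1111 _ _ _ _ _ HK x y); pose proof (k1112 _ _ _ _ _ HK x y);
  pose proof (k1122 _ _ _ _ _ HK x y); pose proof (k1222 _ _ _ _ _ HK x y);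
  pose proof (k2222 _ _ _ _ _ HK x y); lra.

(** This is the equation that the z-derivative of [P + i Q] is 0. The real part is
    [k1111 - 3 k1122 + k2222] and the imaginary part [k1222 - k1112]. *)
Lemma PQ_conj x y :
  dx (eval P) x y + dy (eval Q) x y = 0 /\ dx (eval Q) x y - dy (eval P) x y = 0.
Proof.
  rewrite !dx_eval, !dy_eval. simpl.
  set (m := exp _).
  split.
  - transitivity (m * (dx a x y - 3 * dx c x y - 6 * dx mu x y * (a x y - 3 * c x y)
                  + (dy d x y - 3 * dy b x y - 6 * dy mu x y * (d x y - 3 * b x y))));
      [ring|].
    apply Rmult_eq_0_compat_l. by_killing x y.
  - transitivity (m * (dx d x y - 3 * dx b x y - 6 * dx mu x y * (d x y - 3 * b x y)
                  - (dy a x y - 3 * dy c x y - 6 * dy mu x y * (a x y - 3 * c x y))));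
      [ring|].
    apply Rmult_eq_0_compat_l. by_killing x y.
Qed.

Lemma PQ_constant :
  exists p q, (forall x y, eval P x y = p) /\ (forall x y, eval Q x y = q).
Proof.
  assert (HP : periodic G (eval P)).
  { apply periodic_eval. intros x y x' y' Em Ea Eb Ec Ed. simpl. now rewrite Em, Ea, Ec. }
  assert (HQ : periodic G (eval Q)).
  { apply periodic_eval. intros x y x' y' Em Ea Eb Ec Ed. simpl. now rewrite Em, Ed, Eb. }
  (* By antiholomorphy the harmonic conjugate of [P] is [- Q], and that of [Q] is [P]. *)
  destruct (periodic_CR_constant G (eval P) (eval (Mul (Cst (-1)) Q))) as [p Hp];
    try apply smooth_eval; trivial.
  1,2: intros x y; destruct (PQ_conj x y) as [E1 E2]; revert E1 E2;
    rewrite !dx_eval, !dy_eval; simpl; lra.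
  destruct (periodic_CR_constant G (eval Q) (eval P)) as [q Hq];
    try apply smooth_eval; trivial.
  1,2: intros x y; destruct (PQ_conj x y) as [E1 E2]; lra.
  now exists p, q.
Qed.

(** [(W1, W2)] is the weighted trace [e^{-2 mu} (a + c, b + d)] turned by a right angle, so that its
    closedness is the vanishing of a divergence. *)
Let W1 := Mul (Mul (Cst (-1)) (Add Jb Jd)) (Exp (Mul (Cst (-2)) M)).
Let W2 := Mul (Add Ja Jc) (Exp (Mul (Cst (-2)) M)).

(* The trace part of the Killing equation is the integrability condition. *)
Lemma trace_potential :
  exists u, smooth u /\ dx u = eval W1 /\ dy u = eval W2 /\
    periodic G (dx u) /\ periodic G (dy u).
Proof.
  destruct (potential (eval W1) (eval W2)) as (u & Hu & E1 & E2); try apply smooth_eval.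
  - intros x y. rewrite dy_eval, dx_eval. simpl.
    apply Rminus_diag_uniq. set (m := exp _).
    transitivity (- m * (dx a x y + dx c x y + dy b x y + dy d x y
      - 2 * dx mu x y * (a x y + c x y) - 2 * dy mu x y * (b x y + d x y))); [ring|].
    apply Rmult_eq_0_compat_l. by_killing x y.
  - exists u. rewrite E1, E2. split; [exact Hu|]. do 2 (split; [reflexivity|]).
    split; apply periodic_eval; intros x y x' y' Em Ea Eb Ec Ed; simpl;
      now rewrite Em, ?Ea, ?Eb, ?Ec, ?Ed.
Qed.

Variables (p q : R).
Hypotheses (Hp : forall x y, eval P x y = p) (Hq : forall x y, eval Q x y = q).

Lemma PQ_partials x y :
  dx a x y - 3 * dx c x y = 6 * dx mu x y * (a x y - 3 * c x y) /\
  dy a x y - 3 * dy c x y = 6 * dy mu x y * (a x y - 3 * c x y) /\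
  dx d x y - 3 * dx b x y = 6 * dx mu x y * (d x y - 3 * b x y) /\
  dy d x y - 3 * dy b x y = 6 * dy mu x y * (d x y - 3 * b x y).
Proof.
  assert (Hm := exp_pos (-6 * mu x y)).
  repeat split; apply Rminus_diag_uniq, (Rmult_eq_reg_r (exp (-6 * mu x y))); try lra;
    rewrite Rmult_0_l.
  - rewrite <- (ediff_const P p true Hp x y). simpl. ring.
  - rewrite <- (ediff_const P p false Hp x y). simpl. ring.
  - rewrite <- (ediff_const Q q true Hq x y). simpl. ring.
  - rewrite <- (ediff_const Q q false Hq x y). simpl. ring.
Qed.

(** The constant is [- q + i p = i (p + i q)]. Both equations combine the Killing equations with the
    derivatives from [PQ_partials]. *)
Lemma potential_second_order u :
  dx u = eval W1 -> dy u = eval W2 -> forall x y,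
  dx (dx u) x y - dy (dy u) x y - 2 * (dx mu x y * dx u x y - dy mu x y * dy u x y)
    = 2 * exp (4 * mu x y) * (- q * dx mu x y - p * dy mu x y) /\
  - 2 * dx (dy u) x y + 2 * (dx mu x y * dy u x y + dy mu x y * dx u x y)
    = 2 * exp (4 * mu x y) * (- q * dy mu x y + p * dx mu x y).
Proof.
  intros E1 E2 x y.
  (* Writing [p] and [q] as values of [P] and [Q] turns [e^{4 mu}] into [e^{-2 mu}] by [H6], a
     factor common to all terms. *)
  rewrite <- (Hp x y), <- (Hq x y), E1, E2, !dx_eval, dy_eval. simpl.
  assert (H6 : exp (4 * mu x y) * exp (-6 * mu x y) = exp (-2 * mu x y)).
  { rewrite <- exp_plus. f_equal; ring. }
  destruct (PQ_partials x y) as (Px & Py & Qx & Qy).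
  set (m := exp (-2 * mu x y)) in *.
  split; apply Rminus_diag_uniq.
  - transitivity (- m * (dx b x y + dx d x y + dy a x y + dy c x y
      - 4 * dx mu x y * (b x y + d x y) - 4 * dy mu x y * (a x y + c x y)
      - 2 * dx mu x y * (d x y - 3 * b x y) - 2 * dy mu x y * (a x y - 3 * c x y))).
    { rewrite <- H6. ring. }
    apply Rmult_eq_0_compat_l. by_killing x y.
  - transitivity (2 * m * (- (dx a x y + dx c x y) + 3 * dx mu x y * (a x y + c x y)
      - dy mu x y * (b x y + d x y)
      + dy mu x y * (d x y - 3 * b x y) - dx mu x y * (a x y - 3 * c x y))).
    { rewrite <- H6. ring. }
    apply Rmult_eq_0_compat_l. by_killing x y.
Qed.


(** When [a = 3 c] and [d = 3 b], this is three quarters of the metric trace of the field,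
    normalized so that its symmetric product with the metric is the field itself. *)
Definition trace_vector : tens1 := fun i =>
  eval (Mul (Mul (Cst 3) (match i with I1 => Jc | I2 => Jb end)) (Exp (Mul (Cst (-2)) M))).

Definition metric : tens2 := fun i j =>
  eval (Mul (Cst (delta i j)) (Exp (Mul (Cst 2) M))).

(** The metric is parallel for its Levi-Civita connection. *)
Lemma metric_killing : killing2 G mu metric.
Proof.
  split; [split|].
  - intros i j. apply torus_fun_eval, periodic_eval.
    intros x y x' y' Em Ea Eb Ec Ed. simpl. now rewrite Em.
  - now intros [] [].
  - intros i j k x y. unfold nab2, Chr, sum2, metric, dd.
    destruct i, j, k; rewrite ?dx_eval, ?dy_eval; unfold delta; simpl; ring.
Qed.

Lemma tracefree_zero : p = 0 -> q = 0 -> forall x y, a x y = 3 * c x y /\ d x y = 3 * b x y.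
Proof.
  intros p0 q0 x y. assert (Hm := exp_pos (-6 * mu x y)).
  split; apply Rminus_diag_uniq, (Rmult_eq_reg_r (exp (-6 * mu x y))); try lra;
    rewrite Rmult_0_l.
  - rewrite <- p0, <- (Hp x y). simpl. ring.
  - rewrite <- q0, <- (Hq x y). simpl. ring.
Qed.

(** The derivatives of [a] and [d] are now three times those of [c] and [b], and [k1111], [k1112],
    [k2222] become the three components of Killing's equation for a vector. *)
Lemma trace_vector_killing : p = 0 -> q = 0 -> killing1 G mu trace_vector.
Proof.
  intros p0 q0. split.
  - intros i. apply torus_fun_eval, periodic_eval.
    intros x y x' y' Em Ea Eb Ec Ed. destruct i; simpl; now rewrite Em, ?Eb, ?Ec.
  - intros i j x y.
    destruct (tracefree_zero p0 q0 x y) as [Ha Hd].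
    destruct (PQ_partials x y) as (Px & Py & Qx & Qy).
    assert (H11 := k1111 _ _ _ _ _ HK x y). assert (H12 := k1112 _ _ _ _ _ HK x y).
    assert (H22 := k2222 _ _ _ _ _ HK x y). rewrite ?Ha, ?Hd in *.
    unfold nab1, Chr, sum2, trace_vector, dd.
    destruct i, j; rewrite ?dx_eval, ?dy_eval; unfold delta; simpl; set (m := exp _).
    + transitivity (6 * m * (dx c x y - 3 * dx mu x y * c x y + dy mu x y * b x y)); [ring|].
      apply Rmult_eq_0_compat_l. lra.
    + transitivity (3 * m * (dy c x y + dx b x y - 4 * dx mu x y * b x y
                             - 4 * dy mu x y * c x y)); [ring|].
      apply Rmult_eq_0_compat_l. lra.
    + transitivity (3 * m * (dy c x y + dx b x y - 4 * dx mu x y * b x y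
                             - 4 * dy mu x y * c x y)); [ring|].
      apply Rmult_eq_0_compat_l. lra.
    + transitivity (6 * m * (dy b x y - 3 * dy mu x y * b x y + dx mu x y * c x y)); [ring|].
      apply Rmult_eq_0_compat_l. lra.
Qed.

Lemma sprod_trace_metric i j k x y :
  sprod12 trace_vector metric i j k x y =
  match i, j, k with
  | I1, I1, I1 => 3 * c x y
  | I2, I2, I2 => 3 * b x y
  | I1, I1, I2 | I1, I2, I1 | I2, I1, I1 => b x y
  | _, _, _ => c x y
  end.
Proof.
  assert (E : exp (-2 * mu x y) * exp (2 * mu x y) = 1).
  { rewrite <- exp_plus, <- exp_0. f_equal; ring. }
  unfold sprod12, trace_vector, metric, delta.
  destruct i, j, k; simpl;
    (* The right side receives the factor [e^{-2 mu} e^{2 mu} = 1], which makes both sides agree as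
       rational expressions. *)
    match goal with |- _ = ?r =>
      transitivity (r * (exp (-2 * mu x y) * exp (2 * mu x y))); [field | rewrite E; ring] end.
Qed.

End KillingSystem.

Theorem theorem4p3 (G : lattice) (mu : R -> R -> R) :
  torus_fun G mu ->
  (exists f : tens3, irreducible_killing3 G mu f) ->
  exists c1 c2 : R, (c1 <> 0 \/ c2 <> 0) /\
    exists u : R -> R -> R,
      smooth u /\ periodic G (dx u) /\ periodic G (dy u) /\
      forall x y,
        perpK_u mu u x y = c1 * Lambda1 mu x y + c2 * Lambda2 mu x y /\
        / 2 * LB mu (LB mu u) x y + divKgrad mu u x y
          = - c2 * Lambda1 mu x y + c1 * Lambda2 mu x y.
Proof.
  intros Tmu (f & Hf & Hirr).
  assert (HK := killing3_components G mu f Hf).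
  assert (T := proj1 (proj1 Hf)).
  assert (Ta := T I1 I1 I1). assert (Tb := T I1 I1 I2).
  assert (Tc := T I1 I2 I2). assert (Td := T I2 I2 I2).
  destruct (tens3_normal f (proj2 (proj1 Hf))) as (E1 & E2 & E3 & E4).
  set (a := f I1 I1 I1) in *. set (b := f I1 I1 I2) in *.
  set (c := f I1 I2 I2) in *. set (d := f I2 I2 I2) in *.
  destruct (PQ_constant G mu a b c d Tmu Ta Tb Tc Td HK) as (p & q & Hp & Hq).
  destruct (trace_potential G mu a b c d Tmu Ta Tb Tc Td HK)
    as (u & Hu & Eu1 & Eu2 & Pu1 & Pu2).
  (* [fourth_order] will be used with [A = - q] and [B = p], so the coefficients are [c1 = - B] and
     [c2 = - A]. *)
  exists (- p), q. split.
  - destruct (Req_dec p 0) as [p0|p0]; [|left; lra].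
    destruct (Req_dec q 0) as [q0|q0]; [|now right].
    exfalso. apply Hirr.
    (* A decomposition with a single summand contradicts irreducibility. *)
    exists (P12 (trace_vector G mu b c Tmu Tb Tc) (metric G mu Tmu) :: nil).
    split.
    + constructor; [split | constructor].
      * exact (trace_vector_killing G mu a b c d Tmu Ta Tb Tc Td HK p q Hp Hq p0 q0).
      * exact (metric_killing G mu a b c d Tmu Ta Tb Tc Td).
    + intros i j k x y. unfold sum_prod3; simpl.
      rewrite (sprod_trace_metric G mu b c Tmu Tb Tc).
      destruct (tracefree_zero G mu a b c d Tmu Ta Tb Tc Td p q Hp Hq p0 q0 x y) as [Za Zd].
      destruct i, j, k; rewrite ?E1, ?E2, ?E3, ?E4, Rplus_0_r; trivial.
  - exists u. split; [exact Hu|]. split; [exact Pu1|]. split; [exact Pu2|].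
    intros x y.
    assert (S2 := potential_second_order G mu a b c d Tmu Ta Tb Tc Td HK p q Hp Hq u Eu1 Eu2).
    destruct (fourth_order mu u (proj1 Tmu) Hu (- q) p
                (fun x y => proj1 (S2 x y)) (fun x y => proj2 (S2 x y)) x y) as [F1 F2].
    split; lra.
Qed.
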